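(* Suppose $\mathcal H=\mathbb C^n$ and $1<p,q<\infty$ with $\frac1p+\frac1q=1$. If $f,g\in\mathcal L_{\mathcal H}(X,\nu)$ are such that the functions $x\mapsto\|f(x)\|^pI_n$ and $g^q$ are in $L^1_{\mathcal H}(X,\nu)$ and $f,g\ge 0$, then $g^{1/2}fg^{1/2}\in L^1_{\mathcal H}(X,\nu)$ and $$\|g^{1/2}fg^{1/2}\|_1\le \big\|\,\|f(x)\|^pI_n\big\|_1^{1/p}\,\|g^q\|_1^{1/q}.$$
   Context: Setting. $\mathcal H=\mathbb C^n$, $X$ is a locally compact Hausdorff space, and $\mathcal O(X)$ is the Borel $\sigma$-algebra of $X$. $\mathcal S(\mathcal H)$ is the set of positive trace-one operators in $\mathcal B(\mathcal H)$. $\nu:\mathcal O(X)\to\mathcal B(\mathcal H)$ is a positive operator-valued measure (POVM): $\nu(E)\ge 0$ for all $E$, and $\nu$ is countably additive on disjoint Borel sets. Fix a full-rank $\rho\in\mathcal S(\mathcal H)$ and put $\nu_\rho(E)=\operatorname{Tr}(\rho\,\nu(E))$, a finite positive measure mutually absolutely continuous with $\nu$. For an orthonormal basis $\{e_i\}$ put $\nu_{ij}(E)=\langle\nu(E)e_j,e_i\rangle$ and $\frac{d\nu}{d\nu_\rho}=\big[\frac{d\nu_{ij}}{d\nu_\rho}\big]_{i,j}$, which is positive a.e. ''Almost everywhere'' means with respect to $\nu$, equivalently $\nu_\rho$. A quantum random variable is a Borel measurable $f:X\to\mathcal B(\mathcal H)$ (i.e. $x\mapsto\operatorname{Tr}(sf(x))$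 is Borel for every $s\in\mathcal S(\mathcal H)$). $\mathcal L_{\mathcal H}(X,\nu)$ is the linear span of the positive quantum random variables. For $s\in\mathcal S(\mathcal H)$ set $f_s(x)=\operatorname{Tr}\big(s(\tfrac{d\nu}{d\nu_\rho}(x))^{1/2}f(x)(\tfrac{d\nu}{d\nu_\rho}(x))^{1/2}\big)$. For $f\in\mathcal L_{\mathcal H}(X,\nu)$ let $Pos_f$ be the set of $(f_1,f_2,f_3,f_4)\in\mathcal L_{\mathcal H}(X,\nu)^4$ with all $f_i\ge 0$ and $f=f_1-f_2+if_3-if_4$, and define $$\|f\|_1=\inf_{Pos_f}\ \sup_{s\in\mathcal S(\mathcal H)}\int_X (f_1+f_2+f_3+f_4)_s\,d\nu_\rho\in[0,\infty].$$ $L^1_{\mathcal H}(X,\nu)$ is $\{f\in\mathcal L_{\mathcal H}(X,\nu):\|f\|_1<\infty\}$ modulo $\{f:\|f\|_1=0\}$; a function is said to lie in it when its $\|\cdot\|_1$ is finite. Here $\|f(x)\|$ is the operator norm of $f(x)$, $I_n$ is the identity, and products, powers (functional calculus) and positivity of functions are pointwise (a.e.). *)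

(* Defs.v *)
From HB Require Import structures.
From mathcomp Require Import all_boot all_order all_algebra.
From mathcomp Require Import sesquilinear spectral.
From mathcomp Require Import complex ring.
From mathcomp Require Import all_classical all_reals all_analysis.

Set Implicit Arguments.
Unset Strict Implicit.
Unset Printing Implicit Defensive.

Import Order.TTheory GRing.Theory Num.Theory.
Import numFieldNormedType.Exports.

Local Open Scope classical_set_scope.
Local Open Scope ring_scope.
Local Open Scope sesquilinear_scope.
Local Open Scope charge_scope.

(* Operators on C^n are matrices acting on column vectors in the standard
   basis: <A e_j, e_i> = A i j. *)
Definition psdmx (C : numClosedFieldType) (n : nat) (A : 'M[C]_n) : Prop :=
  forall v : 'cV[C]_n, 0 <= (v ^t* *m A *m v) 0 0.
Section psd.
Context (C : numClosedFieldType) (n : nat).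
Implicit Types A B : 'M[C]_n.

Let qformD A (u v : 'cV[C]_n) (c : C) :
  ((u + c *: v) ^t* *m A *m (u + c *: v)) 0 0
  = (u ^t* *m A *m u) 0 0 + c * (u ^t* *m A *m v) 0 0
    + (c^* * (v ^t* *m A *m u) 0 0 + c^* * (c * (v ^t* *m A *m v) 0 0)).
Proof.
have -> : (u + c *: v) ^t* = u ^t* + c^* *: v ^t*.
  by apply/matrixP => i j; rewrite !mxE rmorphD rmorphM.
set a := u ^t* *m A *m u; set b := u ^t* *m A *m v.
set d := v ^t* *m A *m u; set e := v ^t* *m A *m v.
have -> : (u ^t* + c^* *: v ^t*) *m A *m (u + c *: v)
    = a + c *: b + (c^* *: d + c^* *: (c *: e)).
  by rewrite mulmxDl mulmxDl !mulmxDr -!scalemxAl -!scalemxAr.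
by rewrite !mxE.
Qed.

Let qform_delta A (k l : 'I_n) :
  ((delta_mx k 0 : 'cV_n) ^t* *m A *m (delta_mx l 0 : 'cV_n)) 0 0 = A k l.
Proof. by rewrite trmx_delta map_delta_mx -rowE -colE !mxE. Qed.

Lemma psdmx_herm A : psdmx A -> A ^t* = A.
Proof.
move=> psdA; apply/matrixP => j i; rewrite !mxE.
have diag k : (A k k)^* = A k k.
  have := psdA (delta_mx k 0); rewrite qform_delta => h.
  by apply/CrealP; exact: ger0_real.
have key c : (c * A i j + c^* * A j i) \is Num.real.
  have := psdA (delta_mx i 0 + c *: delta_mx j 0).
  rewrite qformD !qform_delta => /ger0_real H.
  have H2 : (A i i + c^* * (c * A j j)) \is Num.real.
    apply/CrealP; rewrite rmorphD /= !rmorphM /= conjCK !diag.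
    by rewrite [c * _]mulrCA.
  have -> : c * A i j + c^* * A j i = A i i + c * A i j +
      (c^* * A j i + c^* * (c * A j j)) - (A i i + c^* * (c * A j j)).
    by ring.
  exact: rpredB.
have /CrealP k1 := key 1; have /CrealP ki := key 'i.
move: k1 ki; rewrite !rmorphD !rmorphM /= conjCK conjC1 conjCi.
rewrite rmorphN /= conjCi opprK.
set a := A i j; set b := A j i => k1 ki.
have i0 : 2 * 'i != 0 :> C by rewrite mulf_neq0 ?pnatr_eq0 ?neq0Ci.
apply: (mulfI i0).
have -> : 2 * 'i * a^* = 'i * (1 * a^* + 1 * b^*) - (- 'i * a^* + 'i * b^*).
  by ring.
by rewrite k1 ki; ring.
Qed.

Lemma psdmx_tr_ge0 A B : psdmx A -> psdmx B -> 0 <= \tr (A *m B).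
Proof.
move=> psdA psdB.
have /hermitian_normalmx/orthomx_spectralP : A \is hermsymmx.
  by apply/is_hermitianmxP; rewrite expr0 scale1r psdmx_herm.
set P := spectralmx A; set d := spectral_diag A => eA.
have PU : P \is unitarymx by exact: spectral_unitarymx.
have PPs : P *m P^t* = 1%:M by apply/unitarymxP.
have diag_ge0 M k : psdmx M -> 0 <= (P *m M *m P^t*) k k.
  move=> /(_ ((row k P)^t*)); rewrite trmxCK -row_mul.
  congr (0 <= _); rewrite !mxE; apply: eq_bigr => l _.
  by rewrite !mxE.
have dE : P *m A *m P^t* = diag_mx d.
  rewrite eA invmx_unitary// !mulmxA PPs mul1mx.
  by rewrite -mulmxA PPs mulmx1.
have -> : A *m B = P^t* *m (diag_mx d *m (P *m B)).
  by rewrite {1}eA invmx_unitary// !mulmxA.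
rewrite mxtrace_mulC -!mulmxA mul_diag_mx /mxtrace; apply: sumr_ge0 => k _.
rewrite mxE; apply: mulr_ge0.
  by have := diag_ge0 A k psdA; rewrite dE mxE eqxx.
by rewrite mulmxA; exact: diag_ge0.
Qed.
End psd.

Local Open Scope complex_scope.

(* S(C^n): the positive operators of trace one. *)
Record state (R : realType) (n : nat) := State {
  state_mx :> 'M[R[i]]_n ;
  state_psd : psdmx state_mx ;
  state_tr : \tr state_mx = 1 }.

(* Functional calculus t |-> t^r (r > 0) on positive operators.  The value 0
   off the positive cone keeps the map Borel on all matrices. *)
Definition mxpowR (R : realType) (n : nat) (A : 'M[R[i]]_n) (r : R)
    : 'M[R[i]]_n :=
  if `[< psdmx A >] then
    invmx (spectralmx A)
    *m diag_mx (map_mx (fun z => ((complex.Re z) `^ r)%:C) (spectral_diag A))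
    *m spectralmx A
  else 0.

Definition vnorm (R : realType) (n : nat) (v : 'cV[R[i]]_n) : R :=
  Num.sqrt (complex.Re ((v ^t* *m v) 0 0)).

Definition opnorm (R : realType) (n : nat) (A : 'M[R[i]]_n) : R :=
  sup [set vnorm (A *m v) | v in [set v : 'cV[R[i]]_n | vnorm v <= 1]].

Notation Borel X := (g_sigma_algebraType (@open X)).

(* As for the library's measures, the value on a non-measurable set is
   irrelevant but must be positive.  Convergence of the series is entrywise,
   hence for any vector space topology on matrices. *)
Record povm (R : realType) (X : ptopologicalType) (n : nat) := POVM {
  povm_fun :> set (Borel X) -> 'M[R[i]]_n ;
  povm_ge0 : forall E, psdmx (povm_fun E) ;
  povm_sigma_additive : forall F : (set (Borel X))^nat,
    (forall k, measurable (F k)) -> trivIset setT F ->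
    forall i j,
      (fun m => \sum_(0 <= k < m) complex.Re (povm_fun (F k) i j)) @ \oo
        --> complex.Re (povm_fun (\bigcup_k F k) i j) /\
      (fun m => \sum_(0 <= k < m) complex.Im (povm_fun (F k) i j)) @ \oo
        --> complex.Im (povm_fun (\bigcup_k F k) i j) }.

Section povm_measures.
Context (R : realType) (X : ptopologicalType) (n : nat) (nu : povm R X n).

Let cvg_cst_series0 (a : R) :
  (fun m => \sum_(0 <= k < m) a) @ \oo --> a -> a = 0.
Proof.
move=> h; have hc : cvgn (series (fun _ : nat => a)) by apply/cvg_ex; exists a.
have := cvg_series_cvg_0 hc; move/(cvg_lim (@Rhausdorff R)).
by rewrite lim_cst.
Qed.

Lemma povm0 : nu set0 = 0.
Proof.
apply/matrixP => i j; rewrite !mxE.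
have [] := @povm_sigma_additive _ _ _ nu (fun=> set0) (fun=> measurable0)
  (@trivIset_set0 _ _ _) i j.
rewrite bigcup0// => hr hi.
have {}hr := cvg_cst_series0 hr; have {}hi := cvg_cst_series0 hi.
by apply/eqP; rewrite eq_complex hr hi !eqxx.
Qed.

Definition re_entry (i j : 'I_n) (E : set (Borel X)) : \bar R :=
  (complex.Re (nu E i j))%:E.
Definition im_entry (i j : 'I_n) (E : set (Borel X)) : \bar R :=
  (complex.Im (nu E i j))%:E.

Section charges.
Variables i j : 'I_n.

Let re0 : re_entry i j set0 = 0%E.
Proof. by rewrite /re_entry povm0 mxE. Qed.
Let refin E : measurable E -> re_entry i j E \is a fin_num. Proof. by []. Qed.
Let readd : semi_sigma_additive (re_entry i j).
Proof.
move=> F mF tF _; under eq_fun do rewrite /re_entry sumEFin.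
by apply: cvg_EFin; [exact: nearW|exact: (povm_sigma_additive nu mF tF i j).1].
Qed.
HB.instance Definition _ := isCharge.Build _ _ _ (re_entry i j) re0 refin readd.

Let im0 : im_entry i j set0 = 0%E.
Proof. by rewrite /im_entry povm0 mxE. Qed.
Let imfin E : measurable E -> im_entry i j E \is a fin_num. Proof. by []. Qed.
Let imadd : semi_sigma_additive (im_entry i j).
Proof.
move=> F mF tF _; under eq_fun do rewrite /im_entry sumEFin.
by apply: cvg_EFin; [exact: nearW|exact: (povm_sigma_additive nu mF tF i j).2].
Qed.
HB.instance Definition _ := isCharge.Build _ _ _ (im_entry i j) im0 imfin imadd.
End charges.

Definition nu_rho (rho : state R n) (E : set (Borel X)) : \bar R :=
  (complex.Re (\tr (rho *m nu E)))%:E.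

Section measure.
Variable rho : state R n.

Let nr0 : nu_rho rho set0 = 0%E.
Proof. by rewrite /nu_rho povm0 mulmx0 mxtrace0. Qed.

Let nr_ge0 E : (0 <= nu_rho rho E)%E.
Proof.
rewrite lee_fin.
by have := psdmx_tr_ge0 (state_psd rho) (povm_ge0 nu E); rewrite lecE => /andP[].
Qed.

Let re_trE (M : 'M[R[i]]_n) : complex.Re (\tr (rho *m M)) =
  \sum_i \sum_k (complex.Re (rho i k) * complex.Re (M k i)
                 - complex.Im (rho i k) * complex.Im (M k i)).
Proof.
rewrite /mxtrace (raddf_sum (@complex.Re R : Rcomplex R -> R)).
apply: eq_bigr => i _; rewrite mxE.
rewrite (raddf_sum (@complex.Re R : Rcomplex R -> R)).
by apply: eq_bigr => k _; case: (rho i k) => a b; case: (M k i).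
Qed.

Let nr_add : semi_sigma_additive (nu_rho rho).
Proof.
move=> F mF tF _; under eq_fun do rewrite /nu_rho sumEFin.
apply: cvg_EFin; first exact: nearW.
rewrite re_trE; rewrite [X in X @ _ --> _](_ : _ = fun m => \sum_i \sum_k
  (complex.Re (rho i k) * \sum_(0 <= l < m) complex.Re (nu (F l) k i) -
   complex.Im (rho i k) * \sum_(0 <= l < m) complex.Im (nu (F l) k i))).
  have h i k := povm_sigma_additive nu mF tF (k : 'I_n) (i : 'I_n).
  apply: cvg_big => [|i _]; first exact: add_continuous.
  apply: cvg_big => [|k _]; first exact: add_continuous.
  by apply: cvgB; apply: cvgMl_tmp; [exact: (h i k).1|exact: (h i k).2].
apply/funext => m /=.
under eq_bigr do rewrite re_trE.
rewrite exchange_big /=; apply: eq_bigr => i _.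
rewrite exchange_big /=; apply: eq_bigr => k _.
by rewrite sumrB !mulr_sumr.
Qed.
HB.instance Definition _ :=
  isMeasure.Build _ _ _ (nu_rho rho) nr0 nr_ge0 nr_add.

Let nr_fin : fin_num_fun (nu_rho rho). Proof. by []. Qed.
HB.instance Definition _ :=
  Measure_isFinite.Build _ _ _ (nu_rho rho) nr_fin.
End measure.

Variable rho : state R n.

(* d nu / d nu_rho: the derivative of the complex measure nu_ij is taken on
   its real and imaginary parts, which nu_rho dominates when rho has full
   rank. *)
Definition povm_deriv (x : Borel X) : 'M[R[i]]_n :=
  \matrix_(i, j) (fine (('d (re_entry i j) '/d (nu_rho rho)) x) +i*
                  fine (('d (im_entry i j) '/d (nu_rho rho)) x)).

Definition ae_psd (f : Borel X -> 'M[R[i]]_n) : Prop :=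
  {ae nu_rho rho, forall x, psdmx (f x)}.

Definition quantum_rv (f : Borel X -> 'M[R[i]]_n) : Prop :=
  forall s : state R n,
    measurable_fun setT (fun x => complex.Re (\tr (s *m f x))) /\
    measurable_fun setT (fun x => complex.Im (\tr (s *m f x))).

(* The linear span of the positive quantum random variables. *)
Definition LH (f : Borel X -> 'M[R[i]]_n) : Prop :=
  exists (m : nat) (c : 'I_m -> R[i]) (h : 'I_m -> Borel X -> 'M[R[i]]_n),
    (forall k, quantum_rv (h k) /\ ae_psd (h k)) /\
    f = (fun x => \sum_k c k *: h k x).

(* The trace in the definition of f_s; it is real a.e. when f is positive. *)
Definition slice (s : state R n) (f : Borel X -> 'M[R[i]]_n) (x : Borel X)
    : R[i] :=
  \tr (s *m mxpowR (povm_deriv x) 2^-1 *m f x *m mxpowR (povm_deriv x) 2^-1).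

Definition Pos (f f1 f2 f3 f4 : Borel X -> 'M[R[i]]_n) : Prop :=
  [/\ LH f1 /\ ae_psd f1, LH f2 /\ ae_psd f2, LH f3 /\ ae_psd f3,
      LH f4 /\ ae_psd f4 &
      f = (fun x => f1 x - f2 x + 'i *: f3 x - 'i *: f4 x)].

Definition L1norm (f : Borel X -> 'M[R[i]]_n) : \bar R :=
  ereal_inf [set N | exists f1 f2 f3 f4, Pos f f1 f2 f3 f4 /\
    N = ereal_sup (range (fun s : state R n =>
      (\int[nu_rho rho]_x
        (complex.Re
           (slice s (fun x => (f1 x + f2 x + f3 x + f4 x)%R) x))%:E)%E))].

Definition L1 (f : Borel X -> 'M[R[i]]_n) : Prop :=
  LH f /\ (L1norm f < +oo)%E.

End povm_measures.

(* Main.v *)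
Require Import Defs.
From HB Require Import structures.
From mathcomp Require Import all_boot all_order all_algebra.
From mathcomp Require Import sesquilinear spectral.
From mathcomp Require Import complex ring lra.
From mathcomp Require Import all_classical all_reals all_analysis.
From mathcomp Require Import measurable_realfun.

(** The norm of a positive [f] is the supremum over states [s] of the integrals
of [slice s f]: any decomposition [f = f1 - f2 + i f3 - i f4] into positive
functions satisfies [f <= f1 + f2 + f3 + f4], and [(f, 0, 0, 0)] is one of
them ([integral_slice_le_L1norm], [L1norm_le_sup]).

Put [h = g^(1/2) f g^(1/2)].  Since [f <= |f| I] for the operator norm,
[h <= |f| g].  The scalar [|f|] commutes with [g], so Young's inequality for
numbers, applied to the eigenvalues of [g], gives for all [a, b > 0] the
operator inequality

  [h <= a^(1/p) b^(1/q) (|f|^p / (a p) I + g^q / (b q))]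

([scaled_young], [sandwich_young]).  Positive operators pair nonnegatively with
[D^(1/2) s D^(1/2)], where [D] is the derivative of [nu]; so integrating the
slices preserves this inequality.  If [a] and [b] bound the norms of [|f|^p I]
and [g^q], the right-hand side integrates to at most
[a^(1/p) b^(1/q) (1/p + 1/q)], hence [|h|_1 <= a^(1/p) b^(1/q)]
([L1norm_sandwich_le]).  Letting [a] and [b] decrease to the two norms gives
the theorem ([le_powR_product]); no integral form of Hoelder's inequality
enters.

The remaining work is measurability, on which the additivity of the integral
and the membership of [h] in the span of positive random variables depend.  A
function is a quantum random variable iff its entries are measurable, by
polarization.  The square root of a positive matrix is a limit of polynomials
in its entries ([cvg_mxsqrt_iter]), hence measurable; and since a matrix [A] is
positive iff it is the square root of [A A^*], the positive cone is measurable
as well, so that the square root, extended by [0] off the cone, is measurable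
on all matrices ([mxmeasurable_sqrt]). *)

Set Implicit Arguments.
Unset Strict Implicit.
Unset Printing Implicit Defensive.

Import Order.TTheory GRing.Theory Num.Theory.
Import numFieldNormedType.Exports.

Local Open Scope classical_set_scope.
Local Open Scope ring_scope.
Local Open Scope sesquilinear_scope.
Local Open Scope complex_scope.

(** * Positive matrices and functional calculus *)

Section psd_cone.
Context {C : numClosedFieldType} {n : nat}.
Implicit Types A B : 'M[C]_n.

Lemma psdmx0 : psdmx (0 : 'M[C]_n).
Proof. by move=> v; rewrite mulmx0 mul0mx mxE. Qed.

Lemma psdmxD A B : psdmx A -> psdmx B -> psdmx (A + B).
Proof. by move=> a b v; rewrite mulmxDr mulmxDl mxE addr_ge0. Qed.

Lemma psdmxZ (c : C) A : 0 <= c -> psdmx A -> psdmx (c *: A).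
Proof. by move=> c0 a v; rewrite -scalemxAr -scalemxAl mxE mulr_ge0. Qed.

Lemma psdmx_congr m (B : 'M[C]_(m, n)) A : psdmx A -> psdmx (B *m A *m B^t*).
Proof.
move=> a v; have := a (B^t* *m v).
by rewrite trmx_mul map_mxM trmxCK !mulmxA.
Qed.

Lemma psdmx_mul_adj A : psdmx (A *m A^t*).
Proof.
move=> v; rewrite -mulmxA -mulmxA mulmxA.
set w := A^t* *m v; have -> : v^t* *m A = w^t*.
  by rewrite /w trmx_mul map_mxM trmxCK.
by rewrite mxE sumr_ge0// => k _; rewrite !mxE mulrC mul_conjC_ge0.
Qed.

Lemma psdmx1 : psdmx (1%:M : 'M[C]_n).
Proof.
have := psdmx_mul_adj (1%:M : 'M[C]_n).
by rewrite mul1mx trmx1 map_mx1.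
Qed.

End psd_cone.

HB.lock Definition udiag (R : realType) (n : nat) (U : 'M[R[i]]_n)
    (d : 'rV[R]_n) :=
  U^t* *m diag_mx (map_mx (real_complex R) d) *m U.

Section functional_calculus.
Context {R : realType} {n : nat}.
Implicit Types (A U V : 'M[R[i]]_n) (d e : 'rV[R]_n).

Lemma conj_real (x : R) : ((x%:C)^*)%R = x%:C.
Proof. by apply: conj_Creal; apply/complex_realP; exists x. Qed.

Lemma udiagE U d i j :
  udiag U d i j = \sum_k (d 0 k)%:C * (((U k i)^*)%R * U k j).
Proof.
rewrite udiag.unlock -mulmxA mxE; apply: eq_bigr => k _.
by rewrite mul_diag_mx !mxE mulrCA.
Qed.

Lemma udiagD U d e : udiag U (d + e) = udiag U d + udiag U e.
Proof.
apply/matrixP => i j; rewrite [RHS]mxE !udiagE -big_split /=.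
by apply: eq_bigr => k _; rewrite mxE rmorphD mulrDl.
Qed.

Lemma udiagZ U c d : udiag U (c *: d) = c%:C *: udiag U d.
Proof.
apply/matrixP => i j; rewrite [RHS]mxE !udiagE mulr_sumr.
by apply: eq_bigr => k _; rewrite mxE rmorphM mulrA.
Qed.

Lemma udiagB U d e : udiag U (d - e) = udiag U d - udiag U e.
Proof. by rewrite -scaleN1r udiagD udiagZ rmorphN1 scaleN1r. Qed.

Lemma unitarymx_adjM U : U \is unitarymx -> U^t* *m U = 1%:M.
Proof. by move=> uU; apply: mulmx1C; apply/unitarymxP. Qed.

Lemma udiag_const U c : U \is unitarymx -> udiag U (const_mx c) = c%:C%:M.
Proof.
move=> uU; rewrite udiag.unlock map_const_mx diag_const_mx -scalemx1 -scalemxAr.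
by rewrite -scalemxAl mulmx1 unitarymx_adjM.
Qed.

Lemma udiagM U d e : U \is unitarymx ->
  udiag U d *m udiag U e = udiag U (\row_k (d 0 k * e 0 k)).
Proof.
move=> uU.
have E : map_mx (real_complex R) (\row_k (d 0 k * e 0 k)) =
    \row_k (map_mx (real_complex R) d 0 k * map_mx (real_complex R) e 0 k).
  by apply/rowP => k; rewrite !mxE rmorphM.
rewrite udiag.unlock !mulmxA (mulmxtVK _ uU) -(mulmxA (U^t*)) mulmx_diag.
by rewrite E.
Qed.

Lemma udiag_herm U d : (udiag U d)^t* = udiag U d.
Proof.
apply/matrixP => i j; rewrite 2!mxE !udiagE rmorph_sum.
apply: eq_bigr => k _.
by rewrite !rmorphM /= conj_real conjCK [X in _ * X]mulrC.
Qed.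

Lemma udiag_psd U d : (forall k, 0 <= d 0 k) -> psdmx (udiag U d).
Proof.
move=> d0; rewrite udiag.unlock -{2}(trmxCK U); apply: psdmx_congr => v.
rewrite -mulmxA mxE sumr_ge0// => k _.
by rewrite mul_diag_mx !mxE mulrCA mulr_ge0 ?ler0c// mulrC mul_conjC_ge0.
Qed.

Lemma psdmx_hermsym A : psdmx A -> A \is hermsymmx.
Proof.
by move=> a; apply/is_hermitianmxP; rewrite expr0 scale1r psdmx_herm.
Qed.

Lemma psdmx_spectral A : psdmx A ->
  A = (spectralmx A)^t* *m diag_mx (spectral_diag A) *m spectralmx A.
Proof.
move=> a; rewrite -invmx_unitary ?spectral_unitarymx//.
exact/orthomx_spectralP/hermitian_normalmx/psdmx_hermsym.
Qed.

Lemma spectral_diag_ge0 A k : psdmx A -> 0 <= spectral_diag A 0 k.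
Proof.
move=> a; have := psdmx_congr (spectralmx A) a (delta_mx k 0).
rewrite {2}(psdmx_spectral a).
have /unitarymxP PP := spectral_unitarymx A.
rewrite !mulmxA -(mulmxA _ (spectralmx A)) PP mulmx1 -(mulmxA _ (spectralmx A)).
rewrite PP mulmx1 trmx_delta map_delta_mx -rowE -colE !mxE eqxx mulr1n.
by [].
Qed.

Lemma psdmx_udiag A : psdmx A ->
  [/\ spectralmx A \is unitarymx,
      forall k, 0 <= map_mx (@complex.Re R) (spectral_diag A) 0 k &
      A = udiag (spectralmx A) (map_mx (@complex.Re R) (spectral_diag A))].
Proof.
move=> a; split; first exact: spectral_unitarymx.
  by move=> k; have := spectral_diag_ge0 k a; rewrite mxE lecE => /andP[].
have E : map_mx (real_complex R) (map_mx (@complex.Re R) (spectral_diag A)) =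
    spectral_diag A.
  apply/rowP => k; rewrite !mxE /=; have := spectral_diag_ge0 k a.
  rewrite lecE => /andP[/eqP + _].
  by case: (spectral_diag A 0 k) => x y /= ->.
by rewrite udiag.unlock E -(psdmx_spectral a).
Qed.

(** Functional calculus does not depend on the diagonalization: a matrix [W]
with [W d = e W] only links indices with [d j = e i], so it also intertwines
the images of [d] and [e] under [phi].  This is what lets [mxpowR] be computed
from any unitary diagonalization ([mxpowR_udiag]), in spite of its definition
through a chosen one. *)
Lemma udiag_calculus (phi : R -> R) U V d e :
  U \is unitarymx -> V \is unitarymx -> udiag U d = udiag V e ->
  udiag U (map_mx phi d) = udiag V (map_mx phi e).
Proof.
move=> uU uV Ude.
have intertwine (W : 'M[R[i]]_n) :
    W *m diag_mx (map_mx (real_complex R) d) =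
      diag_mx (map_mx (real_complex R) e) *m W ->
    W *m diag_mx (map_mx (real_complex R) (map_mx phi d)) =
      diag_mx (map_mx (real_complex R) (map_mx phi e)) *m W.
  move=> E; apply/matrixP => i j; move: E => /matrixP/(_ i j).
  rewrite !mul_diag_mx !mul_mx_diag !mxE.
  have [->|w0] := eqVneq (W i j) 0; first by rewrite !(mul0r, mulr0).
  rewrite [RHS]mulrC => /(mulfI w0)/(congr1 (@complex.Re R)) /= ->.
  by rewrite mulrC.
have /intertwine E : V *m U^t* *m diag_mx (map_mx (real_complex R) d) =
                     diag_mx (map_mx (real_complex R) e) *m (V *m U^t*).
  have := congr1 (fun M => V *m M *m U^t*) Ude.
  by rewrite udiag.unlock !mulmxA (mulmxtVK _ uU) (unitarymxP uV) mul1mx.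
rewrite udiag.unlock -[in LHS](mul1mx (U^t*)) -(unitarymx_adjM uV) -!mulmxA.
rewrite (mulmxA V) (mulmxA (V *m _)) E -!mulmxA (unitarymx_adjM uU).
by rewrite mulmx1.
Qed.

Lemma mxpowR_udiag U d r : U \is unitarymx -> (forall k, 0 <= d 0 k) ->
  mxpowR (udiag U d) r = udiag U (map_mx (fun t => t `^ r) d).
Proof.
move=> uU d0; have a := udiag_psd U d0.
have [uS _ E] := psdmx_udiag a.
rewrite /mxpowR asboolT// (udiag_calculus (fun t => t `^ r) uU uS E).
by rewrite (invmx_unitary uS) udiag.unlock -!map_mx_comp.
Qed.

Lemma mxpowR_npsd A r : ~ psdmx A -> mxpowR A r = 0.
Proof. by move=> na; rewrite /mxpowR asboolF. Qed.

(** Positivity holds for every matrix, also off the positive cone, where the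
power is [0].  In particular the square root of the derivative of a POVM is
positive everywhere, whatever representative of the derivative is chosen. *)
Lemma mxpowR_psd A r : psdmx (mxpowR A r).
Proof.
have [a|na] := pselect (psdmx A); last first.
  by rewrite mxpowR_npsd//; exact: psdmx0.
have [uS d0 ->] := psdmx_udiag a; rewrite mxpowR_udiag//.
by apply: udiag_psd => k; rewrite mxE powR_ge0.
Qed.

Lemma mxpowR_half_sqr A : psdmx A -> mxpowR (A *m A^t*) 2^-1 = A.
Proof.
move=> a; have [uS d0 E] := psdmx_udiag a.
rewrite {1 2}E udiag_herm udiagM// mxpowR_udiag//; last first.
  by move=> k; rewrite mxE mulr_ge0.
rewrite [RHS]E; congr udiag; apply/rowP => k.
rewrite mxE [in LHS]mxE powR12_sqrt ?mulr_ge0//.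
by rewrite -expr2 sqrtr_sqr ger0_norm.
Qed.

End functional_calculus.

(** * Operator norm and Young's inequality for operators *)

Section operator_norm.
Context {R : realType} {n : nat}.
Implicit Types (A f g : 'M[R[i]]_n).

Lemma psdmx_real_scalar (c : R) : 0 <= c -> psdmx (c%:C%:M : 'M[R[i]]_n).
Proof.
by move=> c0; rewrite -scalemx1; apply: psdmxZ; [rewrite ler0c|exact: psdmx1].
Qed.

Lemma opnorm_ge0 A : 0 <= opnorm A.
Proof.
rewrite /opnorm; set S := (X in sup X).
have [[[x Sx] ubS]|/sup_out ->//] := pselect (has_sup S).
rewrite (le_trans _ (ub_le_sup ubS Sx))//.
by case: Sx => v _ <-; exact: sqrtr_ge0.
Qed.

Lemma vnorm_psd_le A (c : R) (v : 'cV[R[i]]_n) : 0 <= c ->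
  psdmx ((c ^+ 2)%:C%:M - A^t* *m A) -> vnorm (A *m v) <= c * vnorm v.
Proof.
move=> c0 /(_ v).
rewrite mulmxBr mulmxBl mul_mx_scalar -scalemxAl mxE [X in _ + X]mxE.
rewrite [X in X - _]mxE subr_ge0 lecE => /andP[_].
have -> z : complex.Re ((c ^+ 2)%:C * z) = c ^+ 2 * complex.Re z.
  by case: z => x y /=; rewrite mul0r subr0.
rewrite /vnorm trmx_mul map_mxM !mulmxA => h.
by rewrite -[X in X * _]ger0_norm// -sqrtr_sqr -sqrtrM ?sqr_ge0// ler_wsqrtr.
Qed.

(** The eigenvalues of a positive matrix are bounded by its operator norm: each
one is attained as the norm of the image of a unit eigenvector.  The bound by
the sum of the eigenvalues is there only because the supremum defining
[opnorm] must be that of a bounded set. *)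
Lemma psdmx_opnorm A : psdmx A -> psdmx ((opnorm A)%:C%:M - A).
Proof.
move=> a; have [uU d0 E] := psdmx_udiag a.
set U := spectralmx A in uU d0 E; set d := map_mx _ _ in d0 E.
rewrite -(udiag_const _ uU) [in X in _ - X]E -udiagB; apply: udiag_psd => k.
rewrite mxE [X in _ + X]mxE [X in X - _]mxE subr_ge0.
have dsum l : d 0 l <= \sum_m d 0 m.
  by rewrite (bigD1 l)//= lerDl sumr_ge0.
have dsum0 : 0 <= \sum_m d 0 m by rewrite sumr_ge0.
apply: ub_le_sup.
  exists (\sum_m d 0 m) => _ [v v1 <-].
  rewrite (@le_trans _ _ ((\sum_m d 0 m) * vnorm v))//; last first.
    by rewrite ler_piMr.
  apply: vnorm_psd_le => //.
  rewrite E udiag_herm udiagM// -(udiag_const _ uU) -udiagB.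
  apply: udiag_psd => l; rewrite mxE [X in X + _]mxE [X in _ + X]mxE.
  by rewrite [X in - X]mxE -expr2 subr_ge0 lerXn2r ?nnegrE.
(* the unit eigenvector for the eigenvalue [d 0 k] *)
pose v : 'cV[R[i]]_n := U^t* *m delta_mx k 0.
have vE : v^t* *m v = 1%:M.
  rewrite trmx_mul map_mxM trmxCK mulmxA mulmxtVK//.
  rewrite trmx_delta map_delta_mx mul_delta_mx.
  by apply/matrixP => i j; rewrite !ord1 !mxE.
have Av : A *m v = (d 0 k)%:C *: v.
  rewrite E udiag.unlock /v mulmxA mulmxtVK// -mulmxA scalemxAr; congr (_ *m _).
  apply/matrixP => i j; rewrite mul_diag_mx !mxE.
  by case: eqP => [->|]; rewrite /= ?mulr0.
exists v => /=; first by rewrite /vnorm vE mxE /= sqrtr1.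
rewrite Av /vnorm.
have -> : ((d 0 k)%:C *: v)^t* = (d 0 k)%:C *: v^t*.
  by apply/matrixP => i j; rewrite !mxE rmorphM /= conj_real.
rewrite -scalemxAl -scalemxAr vE scalerA -rmorphM scalemx1 mxE mulr1n /=.
by rewrite -expr2 sqrtr_sqr ger0_norm.
Qed.

(** The difference splits as the sum of a function of [g] alone, which is
positive by the scalar inequality on the eigenvalues of [g], and of the positive
[g^(1/2) (|f| I - f) g^(1/2)]. *)
Lemma sandwich_young (c1 c2 p q : R) f g : psdmx f -> psdmx g ->
  (forall u l, 0 <= u -> 0 <= l -> u * l <= c1 * u `^ p + c2 * l `^ q) ->
  psdmx (c1%:C *: (opnorm f `^ p)%:C%:M + c2%:C *: mxpowR g q
         - mxpowR g 2^-1 *m f *m mxpowR g 2^-1).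
Proof.
move=> f0 g0 young; have [uU d0 E] := psdmx_udiag g0.
set U := spectralmx g in uU d0 E; set d := map_mx _ _ in d0 E.
set u := opnorm f; have u0 : 0 <= u := opnorm_ge0 f.
have hE : mxpowR g 2^-1 = udiag U (map_mx (fun t => t `^ 2^-1) d).
  by rewrite {1}E mxpowR_udiag.
have hh : (mxpowR g 2^-1)^t* = mxpowR g 2^-1 by rewrite hE udiag_herm.
have uhh : mxpowR g 2^-1 *m u%:C%:M *m mxpowR g 2^-1 = udiag U (u *: d).
  rewrite mul_mx_scalar -scalemxAl hE udiagM// udiagZ; congr (_ *: udiag _ _).
  apply/rowP => k; have := d0 k; rewrite !mxE => dk.
  by rewrite powR12_sqrt// -expr2 sqr_sqrtr.
have -> : c1%:C *: (u `^ p)%:C%:M + c2%:C *: mxpowR g q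
         - mxpowR g 2^-1 *m f *m mxpowR g 2^-1 =
   (c1%:C *: (u `^ p)%:C%:M + c2%:C *: mxpowR g q - udiag U (u *: d))
   + mxpowR g 2^-1 *m (u%:C%:M - f) *m mxpowR g 2^-1.
  by rewrite mulmxBr mulmxBl uhh addrA addrNK.
apply: psdmxD; last first.
  by rewrite -{2}hh; apply: psdmx_congr; exact: psdmx_opnorm.
have -> : mxpowR g q = udiag U (map_mx (fun t => t `^ q) d).
  by rewrite {1}E mxpowR_udiag.
rewrite -(udiag_const _ uU) -!udiagZ -udiagD -udiagB; apply: udiag_psd => k.
by rewrite mxE !mxE subr_ge0; apply: young => //; have := d0 k; rewrite mxE.
Qed.

End operator_norm.

Section young.
Context {R : realType}.

(** Young's inequality for [u / a^(1/p)] and [l / b^(1/q)].  The scaling makes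
the right-hand side equal to [a^(1/p) b^(1/q)] when [u^p] and [l^q] are
replaced by [a] and [b]. *)
Lemma scaled_young (p q a b u l : R) : 0 < p -> 0 < q -> p^-1 + q^-1 = 1 ->
  0 < a -> 0 < b -> 0 <= u -> 0 <= l ->
  u * l <= a `^ p^-1 * b `^ q^-1 / (a * p) * u `^ p
           + a `^ p^-1 * b `^ q^-1 / (b * q) * l `^ q.
Proof.
move=> p0 q0 pq a0 b0 u0 l0.
set A := a `^ p^-1; set B := b `^ q^-1.
have A0 : 0 < A by exact: powR_gt0.
have B0 : 0 < B by exact: powR_gt0.
have scale (r c v : R) : 0 < r -> 0 < c -> 0 <= v ->
    (v * (c `^ r^-1)^-1) `^ r = v `^ r * c^-1.
  move=> r0 c0 v0; have C0 : 0 < c `^ r^-1 by exact: powR_gt0.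
  have cE : c = (c `^ r^-1) `^ r by rewrite -powRrM mulVf ?gt_eqF// powRr1 ?ltW.
  apply: (@mulIf _ c); rewrite ?gt_eqF// divfK ?gt_eqF// [X in _ * X]cE.
  by rewrite -powRM ?divr_ge0 ?(ltW C0)// divfK ?gt_eqF.
have uA0 : 0 <= u * A^-1 by rewrite divr_ge0 ?(ltW A0).
have lB0 : 0 <= l * B^-1 by rewrite divr_ge0 ?(ltW B0).
have := conjugate_powR uA0 lB0 p0 q0 pq; rewrite !scale// => Y.
have -> : u * l = A * B * (u * A^-1 * (l * B^-1)).
  by field; rewrite !gt_eqF.
have -> : A * B / (a * p) * u `^ p + A * B / (b * q) * l `^ q =
  A * B * (u `^ p * a^-1 / p + l `^ q * b^-1 / q).
  by field; rewrite !gt_eqF.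
by rewrite ler_pM2l ?mulr_gt0.
Qed.

End young.

(** * Measurability of matrix-valued functions *)

Section matrix_measurability.
Context d {T : measurableType d} {R : realType}.

Definition cmeasurable (F : T -> R[i]) : Prop :=
  measurable_fun setT (fun x => complex.Re (F x)) /\
  measurable_fun setT (fun x => complex.Im (F x)).

Definition mxmeasurable m n (F : T -> 'M[R[i]]_(m, n)) : Prop :=
  forall i j, cmeasurable (fun x => F x i j).

Lemma cmeasurable_cst c : cmeasurable (fun=> c).
Proof. by split; exact: measurable_cst. Qed.

Lemma cmeasurable_real (h : T -> R) :
  measurable_fun setT h -> cmeasurable (fun x => (h x)%:C).
Proof. by move=> mh; split => //=; exact: measurable_cst. Qed.

Lemma cmeasurableD F G :
  cmeasurable F -> cmeasurable G -> cmeasurable (fun x => F x + G x).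
Proof.
move=> [Fr Fi] [Gr Gi]; split.
  rewrite [X in measurable_fun _ X](_ : _ =
    fun x => complex.Re (F x) + complex.Re (G x)); first exact: measurable_funD.
  by apply/funext => x; case: (F x) (G x) => ? ? [].
rewrite [X in measurable_fun _ X](_ : _ =
  fun x => complex.Im (F x) + complex.Im (G x)); first exact: measurable_funD.
by apply/funext => x; case: (F x) (G x) => ? ? [].
Qed.

Lemma cmeasurableM F G :
  cmeasurable F -> cmeasurable G -> cmeasurable (fun x => F x * G x).
Proof.
move=> [Fr Fi] [Gr Gi]; split.
  rewrite [X in measurable_fun _ X](_ : _ =
    fun x => complex.Re (F x) * complex.Re (G x)
             - complex.Im (F x) * complex.Im (G x)).
    by apply: measurable_funB; exact: measurable_funM.
  by apply/funext => x; case: (F x) (G x) => ? ? [].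
rewrite [X in measurable_fun _ X](_ : _ =
  fun x => complex.Re (F x) * complex.Im (G x)
           + complex.Im (F x) * complex.Re (G x)).
  by apply: measurable_funD; exact: measurable_funM.
by apply/funext => x; case: (F x) (G x) => ? ? [].
Qed.

Lemma cmeasurable_conj F : cmeasurable F -> cmeasurable (fun x => ((F x)^*)%R).
Proof.
move=> [Fr Fi]; split.
  rewrite [X in measurable_fun _ X](_ : _ = fun x => complex.Re (F x))//.
  by apply/funext => x; case: (F x).
rewrite [X in measurable_fun _ X](_ : _ = fun x => 0 - complex.Im (F x)).
  by apply: measurable_funB => //; exact: measurable_cst.
by apply/funext => x; case: (F x) => ? ? /=; rewrite sub0r.
Qed.

Lemma cmeasurable_sum (I : Type) (s : seq I) (F : I -> T -> R[i]) :
  (forall k, cmeasurable (F k)) -> cmeasurable (fun x => \sum_(k <- s) F k x).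
Proof.
move=> mF; elim: s => [|k s IH].
  by under eq_fun do rewrite big_nil; exact: cmeasurable_cst.
by under eq_fun do rewrite big_cons; exact: cmeasurableD.
Qed.

Lemma mxmeasurable_cst m n (M : 'M[R[i]]_(m, n)) : mxmeasurable (fun=> M).
Proof. by move=> i j; exact: cmeasurable_cst. Qed.

Lemma mxmeasurableD m n (F G : T -> 'M[R[i]]_(m, n)) :
  mxmeasurable F -> mxmeasurable G -> mxmeasurable (fun x => F x + G x).
Proof.
by move=> mF mG i j; under eq_fun do rewrite mxE; exact: cmeasurableD.
Qed.

Lemma mxmeasurableZ m n (h : T -> R[i]) (F : T -> 'M[R[i]]_(m, n)) :
  cmeasurable h -> mxmeasurable F -> mxmeasurable (fun x => h x *: F x).
Proof.
by move=> mh mF i j; under eq_fun do rewrite mxE; exact: cmeasurableM.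
Qed.

Lemma mxmeasurableM m n p
    (F : T -> 'M[R[i]]_(m, n)) (G : T -> 'M[R[i]]_(n, p)) :
  mxmeasurable F -> mxmeasurable G -> mxmeasurable (fun x => F x *m G x).
Proof.
move=> mF mG i j; under eq_fun do rewrite mxE.
by apply: cmeasurable_sum => k; exact: cmeasurableM.
Qed.

Lemma mxmeasurable_adj m n (F : T -> 'M[R[i]]_(m, n)) :
  mxmeasurable F -> mxmeasurable (fun x => (F x)^t*).
Proof.
move=> mF i j; under eq_fun do rewrite mxE mxE.
exact: cmeasurable_conj.
Qed.

Lemma cmeasurable_tr n (F : T -> 'M[R[i]]_n) :
  mxmeasurable F -> cmeasurable (fun x => \tr (F x)).
Proof. by move=> mF; exact: cmeasurable_sum. Qed.

End matrix_measurability.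

Section square_root.
Context {R : realType}.

(** Iteration for the root of [y * y = t].  It converges from below when
[Num.sqrt t <= c], and it only uses sums and products, so that the same
formula makes sense for matrices. *)
Fixpoint sqrt_iter (c t : R) (k : nat) : R :=
  if k is k'.+1 then
    let y := sqrt_iter c t k' in y + (2 * c)^-1 * (t - y * y)
  else 0.

(** The error is multiplied at each step by [1 - (sqrt t + y) / (2 c)], which
lies between [0] and [1 - sqrt t / (2 c)]; the iterates stay below the root
and the error decreases geometrically unless [t = 0], where all iterates
vanish. *)
Lemma sqrt_iter_bound (c t : R) k : 0 < c -> 0 <= t -> Num.sqrt t <= c ->
  0 <= sqrt_iter c t k <= Num.sqrt t /\
  Num.sqrt t - sqrt_iter c t k
    <= geometric (Num.sqrt t) (1 - Num.sqrt t / (2 * c)) k.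
Proof.
move=> c0 t0 sc; have s0 := sqrtr_ge0 t; set s := Num.sqrt t in sc s0 *.
have st : t = s * s by rewrite -expr2 sqr_sqrtr.
have i0 : 0 < (2 * c)^-1 by rewrite invr_gt0 mulr_gt0.
have i1 : (2 * c)^-1 * (2 * c) = 1 by rewrite mulVf ?gt_eqF ?mulr_gt0.
elim: k => [|k] /=; first by rewrite lexx s0 expr0 mulr1 subr0.
set y := sqrt_iter c t k; set i := (2 * c)^-1 in i0 i1 *.
move=> [/andP[y0 ys]] IH.
have step : s - (y + i * (t - y * y)) = (s - y) * (1 - (s + y) * i).
  by rewrite st; ring.
have r0 : 0 <= 1 - (s + y) * i.
  rewrite subr_ge0 -i1 mulrC ler_pM2l//; lra.
split.
  apply/andP; split.
    apply: addr_ge0 => //; apply: mulr_ge0; rewrite ?(ltW i0)//.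
    by rewrite subr_ge0 st ler_pM.
  by rewrite -subr_ge0 step mulr_ge0// subr_ge0.
rewrite step exprSr mulrA ler_pM//; first by rewrite subr_ge0.
by rewrite lerD2l lerN2 ler_pM2r// lerDl.
Qed.

Lemma cvg_sqrt_iter (c t : R) : 0 < c -> 0 <= t -> Num.sqrt t <= c ->
  sqrt_iter c t k @[k --> \oo] --> Num.sqrt t.
Proof.
move=> c0 t0 sc; have B k := sqrt_iter_bound k c0 t0 sc.
set s := Num.sqrt t in sc B *.
have [s0|s0] := eqVneq s 0.
  rewrite (_ : (fun k => _) = cst s); first exact: cvg_cst.
  apply/funext => k /=; have [/andP[y0 ys] _] := B k.
  by apply/eqP; rewrite eq_le ys s0 y0.
have {}s0 : 0 < s by rewrite lt_neqAle eq_sym s0 sqrtr_ge0.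
have z1 : `|1 - s / (2 * c)| < 1.
  have h0 : 0 < s / (2 * c) by rewrite divr_gt0 ?mulr_gt0.
  have h1 : s / (2 * c) <= 1 by rewrite ler_pdivrMr ?mulr_gt0//; lra.
  by rewrite ger0_norm; lra.
apply: (@squeeze_cvgr _ _ _ _
  (fun k => s - geometric s (1 - s / (2 * c)) k) (cst s)).
- apply: nearW => k; have [/andP[_ ->]] := B k.
  by rewrite andbT lerBlDr -lerBlDl.
- rewrite -[X in _ --> X]subr0; apply: cvgB; first exact: cvg_cst.
  exact: cvg_geometric.
- exact: cvg_cst.
Qed.

Fixpoint mxsqrt_iter n (c : R) (A : 'M[R[i]]_n) (k : nat) : 'M[R[i]]_n :=
  if k is k'.+1 then
    let Y := mxsqrt_iter c A k' in Y + ((2 * c)^-1)%:C *: (A - Y *m Y)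
  else 0.

Lemma mxsqrt_iter_udiag n c (U : 'M[R[i]]_n) e k : U \is unitarymx ->
  mxsqrt_iter c (udiag U e) k = udiag U (map_mx (fun t => sqrt_iter c t k) e).
Proof.
move=> uU; elim: k => [|k /= ->].
  rewrite /= (_ : map_mx _ e = const_mx 0) ?udiag_const//.
    by rewrite raddf0.
  by apply/rowP => j; rewrite !mxE.
rewrite udiagM// -udiagB -udiagZ -udiagD; congr udiag.
by apply/rowP => j; rewrite !mxE.
Qed.

Lemma Re_udiag n (U : 'M[R[i]]_n) e i j :
  complex.Re (udiag U e i j) =
  \sum_k e 0 k * complex.Re (((U k i)^*)%R * U k j).
Proof.
rewrite udiagE (raddf_sum (@complex.Re R : Rcomplex R -> R)).
apply: eq_bigr => k _; case: (((U k i)^*)%R * U k j) => x y /=.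
by rewrite mul0r subr0.
Qed.

Lemma Im_udiag n (U : 'M[R[i]]_n) e i j :
  complex.Im (udiag U e i j) =
  \sum_k e 0 k * complex.Im (((U k i)^*)%R * U k j).
Proof.
rewrite udiagE (raddf_sum (@complex.Im R : Rcomplex R -> R)).
apply: eq_bigr => k _; case: (((U k i)^*)%R * U k j) => x y /=.
by rewrite mul0r addr0.
Qed.

Lemma mxtrace_udiag n (U : 'M[R[i]]_n) e : U \is unitarymx ->
  complex.Re (\tr (udiag U e)) = \sum_k e 0 k.
Proof.
move=> uU; rewrite udiag.unlock -mulmxA mxtrace_mulC mulmxtVK// mxtrace_diag.
rewrite (raddf_sum (@complex.Re R : Rcomplex R -> R)).
by apply: eq_bigr => k _; rewrite mxE.
Qed.

(** The constant [1 + \tr A] dominates the square root of each eigenvalue of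
[A], because [sqrt t <= 1 + t], and it depends measurably on [A]. *)
Lemma cvg_mxsqrt_iter n (A : 'M[R[i]]_n) i j : psdmx A ->
  complex.Re (mxsqrt_iter (1 + complex.Re (\tr A)) A k i j) @[k --> \oo]
    --> complex.Re (mxpowR A 2^-1 i j) /\
  complex.Im (mxsqrt_iter (1 + complex.Re (\tr A)) A k i j) @[k --> \oo]
    --> complex.Im (mxpowR A 2^-1 i j).
Proof.
move=> a; have [uU d0 E] := psdmx_udiag a.
set U := spectralmx A in uU d0 E; set d := map_mx _ _ in d0 E.
rewrite {}E mxpowR_udiag// mxtrace_udiag//; set c := 1 + _.
have cvgd k : sqrt_iter c (d 0 k) l @[l --> \oo] --> d 0 k `^ 2^-1.
  have dc : d 0 k <= c - 1.
    by rewrite /c addrC addKr (bigD1 k)//= lerDl sumr_ge0.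
  have dk := d0 k; rewrite powR12_sqrt//; apply: cvg_sqrt_iter => //; first lra.
  rewrite -[leRHS]ger0_norm; last lra.
  rewrite -sqrtr_sqr ler_wsqrtr//; nra.
split.
  rewrite Re_udiag; under eq_fun do rewrite mxsqrt_iter_udiag// Re_udiag.
  apply: cvg_big => [|k _]; first exact: add_continuous.
  apply: cvgMr_tmp; rewrite mxE; under eq_fun do rewrite mxE.
  exact: cvgd.
rewrite Im_udiag; under eq_fun do rewrite mxsqrt_iter_udiag// Im_udiag.
apply: cvg_big => [|k _]; first exact: add_continuous.
apply: cvgMr_tmp; rewrite mxE; under eq_fun do rewrite mxE.
exact: cvgd.
Qed.

End square_root.

Section measurable_square_root.
Context dT {T : measurableType dT} {R : realType} {n : nat}.
Implicit Types F : T -> 'M[R[i]]_n.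

Lemma mxmeasurable_sqrt_psd F : (forall x, psdmx (F x)) ->
  mxmeasurable F -> mxmeasurable (fun x => mxpowR (F x) 2^-1).
Proof.
move=> F0 mF.
have miter k : mxmeasurable (fun x =>
    mxsqrt_iter (1 + complex.Re (\tr (F x))) (F x) k).
  elim: k => [|k IH] /=; first exact: mxmeasurable_cst.
  apply: mxmeasurableD => //; apply: mxmeasurableZ.
    apply: cmeasurable_real.
    have tr0 x : 0 <= complex.Re (\tr (F x)).
      have [uU d0 ->] := psdmx_udiag (F0 x).
      by rewrite mxtrace_udiag// sumr_ge0.
    (* on nonnegative numbers inversion is the Borel function [powR ^~ (-1)] *)
    have -> : (fun x => (2 * (1 + complex.Re (\tr (F x))))^-1) =
        (@powR R ^~ (-1)) \o (fun x => 2 * (1 + complex.Re (\tr (F x)))).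
      by apply/funext => x /=; rewrite powR_inv1 ?mulr_ge0 ?addr_ge0.
    apply: measurableT_comp; first exact: measurable_powR.
    apply: measurable_funM; first exact: measurable_cst.
    apply: measurable_funD; first exact: measurable_cst.
    exact: (cmeasurable_tr mF).1.
  rewrite (_ : (fun x => _ - _) = (fun x => F x + (-1) *:
    (mxsqrt_iter (1 + complex.Re (\tr (F x))) (F x) k
     *m mxsqrt_iter (1 + complex.Re (\tr (F x))) (F x) k))); last first.
    by apply/funext => x; rewrite scaleN1r.
  apply: mxmeasurableD => //; apply: mxmeasurableZ; last exact: mxmeasurableM.
  exact: cmeasurable_cst.
move=> i j; split; apply: measurable_fun_cvg (fun k => _) _.
- exact: (fun k => (miter k i j).1).
- by move=> x _; exact: (cvg_mxsqrt_iter i j (F0 x)).1.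
- exact: (fun k => (miter k i j).2).
- by move=> x _; exact: (cvg_mxsqrt_iter i j (F0 x)).2.
Qed.

(** Since [A A^*] is positive for every [A], this describes the positive cone
using square roots of positive matrices only; it yields the measurability of
the cone from [mxmeasurable_sqrt_psd]. *)
Lemma psdmx_sqrtE (A : 'M[R[i]]_n) :
  `[< psdmx A >] = (A == mxpowR (A *m A^t*) 2^-1).
Proof.
apply/asboolP/eqP => [a|->]; last exact: mxpowR_psd.
by rewrite mxpowR_half_sqr.
Qed.

Lemma measurable_eq_mx m p (F G : T -> 'M[R[i]]_(m, p)) :
  mxmeasurable F -> mxmeasurable G ->
  measurable_fun setT (fun x => F x == G x).
Proof.
move=> mF mG.
have -> : (fun x => F x == G x) = (fun x => \big[andb/true]_i \big[andb/true]_j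
    ((complex.Re (F x i j) == complex.Re (G x i j))
    && (complex.Im (F x i j) == complex.Im (G x i j)))).
  apply/funext => x; rewrite big_andE; apply/eqP/forallP => [-> i|h].
    by rewrite big_andE; apply/forallP => j; rewrite !eqxx.
  apply/matrixP => i j; have := h i; rewrite big_andE => /forallP/(_ j).
  by rewrite -eq_complex => /eqP.
have mbig (I : finType) (P : I -> T -> bool) :
    (forall i, measurable_fun setT (P i)) ->
    measurable_fun setT (fun x => \big[andb/true]_i P i x).
  move=> mP; elim: (index_enum I) => [|i s IH].
    by under eq_fun do rewrite big_nil; exact: measurable_cst.
  by under eq_fun do rewrite big_cons; exact: measurable_and.
apply: (mbig) => i; apply: mbig => j.
apply: measurable_and; apply: measurable_fun_eqr.
- exact: (mF _ _).1.
- exact: (mG _ _).1.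
- exact: (mF _ _).2.
- exact: (mG _ _).2.
Qed.

Lemma mxmeasurable_sqrt F :
  mxmeasurable F -> mxmeasurable (fun x => mxpowR (F x) 2^-1).
Proof.
move=> mF; pose P x := `[< psdmx (F x) >].
have mP : measurable_fun setT P.
  rewrite (_ : P = fun x => F x == mxpowR (F x *m (F x)^t*) 2^-1).
    apply: measurable_eq_mx => //; apply: mxmeasurable_sqrt_psd.
      by move=> x; exact: psdmx_mul_adj.
    by apply: mxmeasurableM => //; exact: mxmeasurable_adj.
  by apply/funext => x; exact: psdmx_sqrtE.
pose G x := if P x then F x else 0.
have G0 x : psdmx (G x).
  by rewrite /G; case: ifPn => [/asboolP//|_]; exact: psdmx0.
have mG : mxmeasurable G.
  move=> i j; have E x : G x i j = if P x then F x i j else 0.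
    by rewrite /G; case: ifP => //; rewrite mxE.
  split; under eq_fun do
    rewrite E (fun_if (@complex.Re R), fun_if (@complex.Im R)).
    by apply: measurable_fun_ifT => //; exact: (mF _ _).1.
  by apply: measurable_fun_ifT => //; exact: (mF _ _).2.
have mS := mxmeasurable_sqrt_psd G0 mG.
have E x : mxpowR (F x) 2^-1 = if P x then mxpowR (G x) 2^-1 else 0.
  rewrite /G; case Px: (P x) => //; apply: mxpowR_npsd => a.
  by rewrite /P asboolT in Px.
move=> i j; have {}E x : mxpowR (F x) 2^-1 i j
    = if P x then mxpowR (G x) 2^-1 i j else 0.
  by rewrite E; case: ifP => //; rewrite mxE.
split; under eq_fun do
    rewrite E (fun_if (@complex.Re R), fun_if (@complex.Im R)).
  by apply: measurable_fun_ifT => //; exact: (mS _ _).1.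
by apply: measurable_fun_ifT => //; exact: (mS _ _).2.
Qed.

End measurable_square_root.

(** * Quantum random variables *)

Section quantum_random_variables.
Context {R : realType} {X : ptopologicalType} {n : nat}.
Implicit Types f : Borel X -> 'M[R[i]]_n.

Lemma polarization (M : 'M[R[i]]_n) (i j : 'I_n)
    (Q := fun v : 'cV[R[i]]_n => (v^t* *m M *m v) 0 0)
    (e := fun k : 'I_n => delta_mx k 0 : 'cV[R[i]]_n) :
  M i j = 2^-1 * (Q (e i + e j) - 'i * Q (e i + 'i *: e j)
                  - (1 - 'i) * (Q (e i) + Q (e j))).
Proof.
have eME k l : ((e k)^t* *m M *m e l) 0 0 = M k l.
  by rewrite trmx_delta map_delta_mx -rowE -colE !mxE.
have QE c : Q (e i + c *: e j) =
    M i i + c * M i j + (c^*)%R * (M j i + c * M j j).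
  rewrite /Q; have -> : (e i + c *: e j)^t* = (e i)^t* + (c^*)%R *: (e j)^t*.
    by apply/matrixP => k l; rewrite !mxE rmorphD rmorphM.
  rewrite mulmxDl mulmxDl !mulmxDr -!scalemxAl -!scalemxAr -!eME !mxE.
  by rewrite mulrDr.
have -> : e i + e j = e i + 1 *: e j by rewrite scale1r.
rewrite !QE /Q !eME conjC1 conjCi.
have i2 : 'i * 'i = -1 :> R[i] by rewrite -expr2 sqrCi.
apply: (@mulfI _ 2); first by rewrite pnatr_eq0.
rewrite mulrA divff ?pnatr_eq0// mul1r.
by ring: i2.
Qed.

(** The pure states [v v^* / (v^* v)] give the measurability of the quadratic
forms [v^* f v], and these determine the entries by polarization. *)
Lemma quantum_rv_mxmeasurable f : quantum_rv f -> mxmeasurable f.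
Proof.
move=> qf.
have mform (v : 'cV[R[i]]_n) : cmeasurable (fun x => (v^t* *m f x *m v) 0 0).
  have [->|v0] := eqVneq v 0.
    under eq_fun do rewrite mulmx0 mxE.
    exact: cmeasurable_cst.
  pose c := (v^t* *m v) 0 0.
  have c_ge0 : 0 <= c.
    by have := psdmx1 v; rewrite mulmx1.
  have c0 : c != 0.
    apply: contra v0; rewrite /c mxE psumr_eq0 => [/allP h|k _]; last first.
      by rewrite !mxE mulrC mul_conjC_ge0.
    apply/eqP/colP => k; rewrite mxE; apply/eqP.
    by have := h k (mem_index_enum k); rewrite !mxE mulrC mul_conjC_eq0.
  have spsd : psdmx (c^-1 *: (v *m v^t*)).
    apply: psdmxZ; first by rewrite invr_ge0.
    have := psdmx_congr v (psdmx1 : psdmx (1%:M : 'M[R[i]]_1)).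
    by rewrite mulmx1.
  have str : \tr (c^-1 *: (v *m v^t*)) = 1.
    by rewrite mxtraceZ mxtrace_mulC trace_mx11 mulVf.
  have -> : (fun x => (v^t* *m f x *m v) 0 0) =
      (fun x => c * \tr (State spsd str *m f x)).
    apply/funext => x /=; rewrite -scalemxAl mxtraceZ mulrA divff// mul1r.
    by rewrite -[in RHS]mulmxA mxtrace_mulC trace_mx11.
  by apply: cmeasurableM; [exact: cmeasurable_cst|exact: qf].
move=> i j; under eq_fun do rewrite polarization.
apply: cmeasurableM; first exact: cmeasurable_cst.
have mB F G : cmeasurable F -> cmeasurable G ->
    cmeasurable (fun x : Borel X => F x - G x : R[i]).
  move=> mF mG; under eq_fun do rewrite -mulN1r.
  by apply: cmeasurableD => //; apply: cmeasurableM.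
apply: (mB); first apply: (mB) => //.
  by apply: cmeasurableM => //; exact: cmeasurable_cst.
by apply: cmeasurableM; [exact: cmeasurable_cst|exact: cmeasurableD].
Qed.

Lemma mxmeasurable_quantum_rv f : mxmeasurable f -> quantum_rv f.
Proof.
by move=> mf s; apply: cmeasurable_tr; apply: mxmeasurableM.
Qed.

Variables (nu : povm R X n) (rho : state R n).

Lemma LH_mxmeasurable f : LH nu rho f -> mxmeasurable f.
Proof.
move=> [m [c [h [qh ->]]]] i j; under eq_fun do rewrite summxE.
apply: cmeasurable_sum => k; apply: mxmeasurableZ; first exact: cmeasurable_cst.
exact: quantum_rv_mxmeasurable (qh k).1.
Qed.

Lemma mxmeasurable_LH f : mxmeasurable f -> ae_psd nu rho f -> LH nu rho f.
Proof.
move=> mf pf; exists 1%N, (fun=> 1), (fun=> f); split.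
  by move=> _; split => //; exact: mxmeasurable_quantum_rv.
by apply/funext => x; rewrite big_ord1 scale1r.
Qed.

(** Without absolute continuity the derivative is the constant [-oo]. *)
Lemma measurable_Radon_Nikodym d (T : measurableType d)
    (m : {sigma_finite_measure set T -> \bar R})
    (la : {charge set T -> \bar R}) :
  measurable_fun setT (Radon_Nikodym la m).
Proof.
have [lam|nlam] := pselect (la `<< m).
  exact: measurable_int (Radon_Nikodym_integrable lam).
rewrite /Radon_Nikodym; case: pselect => // _; exact: measurable_cst.
Qed.

Lemma mxmeasurable_povm_deriv : mxmeasurable (povm_deriv nu rho).
Proof.
move=> i j; under eq_fun do rewrite mxE.
by split => /=; (apply: measurableT_comp; first exact: fine_measurable);
  exact: measurable_Radon_Nikodym.
Qed.

Lemma measurable_slice s f : mxmeasurable f ->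
  measurable_fun setT (fun x => complex.Re (slice nu rho s f x)).
Proof.
move=> mf; have mD := mxmeasurable_sqrt mxmeasurable_povm_deriv.
suff : cmeasurable (slice nu rho s f) by case.
apply: cmeasurable_tr; do 2 apply: mxmeasurableM => //.
by apply: mxmeasurableM => //; exact: mxmeasurable_cst.
Qed.

(** By cyclicity the slice is the trace of the product of the two positive
matrices [D^(1/2) s D^(1/2)] and [f x]. *)
Lemma slice_ge0 s f x : psdmx (f x) -> 0 <= slice nu rho s f x.
Proof.
move=> fx; rewrite /slice; set B := mxpowR _ _.
have B0 : psdmx B by exact: mxpowR_psd.
have -> : \tr (s *m B *m f x *m B) = \tr (B *m s *m B *m f x).
  by rewrite mxtrace_mulC !mulmxA.
apply: psdmx_tr_ge0 => //; rewrite -{2}(psdmx_herm B0).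
by apply: psdmx_congr; exact: state_psd.
Qed.

End quantum_random_variables.

(** * Slices and the norm of positive functions *)

Section ae_monotone_integral.
Context d {T : measurableType d} {R : realType}.
Variable mu : {measure set T -> \bar R}.

(** The smaller function may change sign: its negative part only lowers its
integral. *)
Lemma ae_le_integral (F G : T -> R) :
  measurable_fun setT F -> measurable_fun setT G ->
  {ae mu, forall x, F x <= G x} -> {ae mu, forall x, 0 <= G x} ->
  (\int[mu]_x (F x)%:E <= \int[mu]_x (G x)%:E)%E.
Proof.
move=> mF mG FG G0.
have mFE : measurable_fun setT (EFin \o F) by exact/measurable_EFinP.
have mGE : measurable_fun setT (EFin \o G) by exact/measurable_EFinP.
have -> : (\int[mu]_x (G x)%:E = \int[mu]_x ((EFin \o G)^\+ x))%E.
  apply: ae_eq_integral => //; first exact: measurable_funepos.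
  by apply: filterS G0 => x Gx _; rewrite funeposE /= max_l// lee_fin.
rewrite integralE (@le_trans _ _ (\int[mu]_x (EFin \o F)^\+ x)%E)//.
  by rewrite geeDl// oppe_le0 integral_ge0.
apply: ae_ge0_le_integral => //; [exact: measurable_funepos..|].
apply: filterS FG => x FGx _.
by rewrite !funeposE /= ge_max !le_max lee_fin FGx lexx orbT.
Qed.

End ae_monotone_integral.

Section L1_norm.
Context {R : realType} {X : ptopologicalType} {n : nat}.
Variables (nu : povm R X n) (rho : state R n).
Implicit Types (f g : Borel X -> 'M[R[i]]_n) (s : state R n).

Lemma ReB (x y : R[i]) : complex.Re (x - y) = complex.Re x - complex.Re y.
Proof. by case: x y => ? ? []. Qed.

Lemma Re_slice_ge0 s f x : psdmx (f x) -> 0 <= complex.Re (slice nu rho s f x).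
Proof. by move=> /(slice_ge0 nu rho s); rewrite lecE => /andP[]. Qed.

Lemma slice_le s f g x : psdmx (g x - f x) ->
  complex.Re (slice nu rho s f x) <= complex.Re (slice nu rho s g x).
Proof.
move=> fg; rewrite -subr_ge0 -ReB.
have := @Re_slice_ge0 s (fun y => g y - f y) x fg.
by rewrite /slice mulmxBr mulmxBl raddfB.
Qed.

(** As [x] and the [xi] are real, the imaginary part of the decomposition gives
[x3 = x4], so that the conclusion is [0 <= 2 x2 + x3 + x4]. *)
Lemma le_add_of_decomposition (x x1 x2 x3 x4 : R[i]) : 0 <= x ->
  0 <= x1 -> 0 <= x2 -> 0 <= x3 -> 0 <= x4 ->
  x = x1 - x2 + 'i%C * x3 - 'i%C * x4 -> 0 <= x1 + x2 + x3 + x4 - x.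
Proof.
case: x x1 x2 x3 x4 => [x y] [x1 y1] [x2 y2] [x3 y3] [x4 y4].
rewrite !lecE /= => /andP[/eqP e _].
move=> /andP[/eqP e1 ?] /andP[/eqP e2 ?] /andP[/eqP e3 ?] /andP[/eqP e4 ?].
move=> [E1 E2]; apply/andP; split; [apply/eqP|]; lra.
Qed.

Lemma le_pos_sum (A A1 A2 A3 A4 : 'M[R[i]]_n) : psdmx A ->
  psdmx A1 -> psdmx A2 -> psdmx A3 -> psdmx A4 ->
  A = A1 - A2 + 'i *: A3 - 'i *: A4 -> psdmx (A1 + A2 + A3 + A4 - A).
Proof.
move=> a a1 a2 a3 a4 AE v.
have qD (M N : 'M[R[i]]_n) : (v^t* *m (M + N) *m v) 0 0 =
    (v^t* *m M *m v) 0 0 + (v^t* *m N *m v) 0 0.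
  by rewrite mulmxDr mulmxDl mxE.
have qB (M N : 'M[R[i]]_n) : (v^t* *m (M - N) *m v) 0 0 =
    (v^t* *m M *m v) 0 0 - (v^t* *m N *m v) 0 0.
  by rewrite mulmxBr mulmxBl mxE [X in _ + X]mxE.
have qZ (c : R[i]) (M : 'M[R[i]]_n) :
    (v^t* *m (c *: M) *m v) 0 0 = c * (v^t* *m M *m v) 0 0.
  by rewrite -scalemxAr -scalemxAl mxE.
rewrite qB !qD; apply: le_add_of_decomposition => //.
by rewrite {1}AE qB qD qB !qZ complexiE.
Qed.

Lemma integral_slice_le_L1norm s f : LH nu rho f -> ae_psd nu rho f ->
  (\int[nu_rho nu rho]_x (complex.Re (slice nu rho s f x))%:E
   <= L1norm nu rho f)%E.
Proof.
move=> Lf f0; apply: le_ereal_inf_tmp => _ [f1 [f2 [f3 [f4 [P ->]]]]].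
case: P => -[M1 p1] [M2 p2] [M3 p3] [M4 p4] fE.
apply: le_trans; last by apply: ereal_sup_ubound; exists s.
have mS : mxmeasurable (fun x => f1 x + f2 x + f3 x + f4 x).
  have mf h : LH nu rho h -> mxmeasurable h by exact: LH_mxmeasurable.
  by do 3 (apply: mxmeasurableD => //; last exact: mf); exact: mf.
have ps : {ae nu_rho nu rho, forall x,
    [/\ psdmx (f1 x), psdmx (f2 x), psdmx (f3 x) & psdmx (f4 x)]}.
  by apply: filterS2 (filterI p1 p2) (filterI p3 p4) => x [] ? ? [].
apply: ae_le_integral.
- by apply: measurable_slice; exact: LH_mxmeasurable Lf.
- exact: measurable_slice.
- apply: filterS2 f0 ps => x fx [g1 g2 g3 g4]; apply: slice_le.
  exact: le_pos_sum fx g1 g2 g3 g4 (congr1 (fun F => F x) fE).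
- apply: filterS ps => x [g1 g2 g3 g4]; apply: Re_slice_ge0.
  exact: psdmxD (psdmxD (psdmxD g1 g2) g3) g4.
Qed.

Lemma L1norm_le_sup f : LH nu rho f -> ae_psd nu rho f ->
  (L1norm nu rho f <= ereal_sup (range (fun s : state R n =>
    (\int[nu_rho nu rho]_x (complex.Re (slice nu rho s f x))%:E)%E)))%E.
Proof.
move=> Lf f0; apply: ereal_inf_lbound.
have L0 : LH nu rho (fun=> 0) /\ ae_psd nu rho (fun=> 0).
  have p0 : ae_psd nu rho (fun=> 0) by apply: aeW => x; exact: psdmx0.
  by split => //; apply: mxmeasurable_LH => //; exact: mxmeasurable_cst.
exists f, (fun=> 0), (fun=> 0), (fun=> 0); split.
  split; [exact: conj Lf f0|exact: L0|exact: L0|exact: L0|].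
  by apply/funext => x; rewrite !scaler0 !subr0 addr0.
suff -> : (fun x => f x + 0 + 0 + 0) = f by [].
by apply/funext => x; rewrite !addr0.
Qed.

End L1_norm.

(** * The inequality *)

Section sandwich.
Context {R : realType} {X : ptopologicalType} {n : nat}.
Variables (nu : povm R X n) (rho : state R n).
Implicit Types (f g : Borel X -> 'M[R[i]]_n) (s : state R n).

Local Notation sandwich f g :=
  (fun x => mxpowR (g x) 2^-1 *m f x *m mxpowR (g x) 2^-1).

Lemma LH_sandwich f g : LH nu rho f -> LH nu rho g -> ae_psd nu rho f ->
  LH nu rho (sandwich f g) /\ ae_psd nu rho (sandwich f g).
Proof.
move=> Lf Lg f0.
have h0 : ae_psd nu rho (sandwich f g).
  apply: filterS f0 => x fx.
  rewrite -{2}(psdmx_herm (mxpowR_psd (g x) 2^-1)); exact: psdmx_congr.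
split => //; apply: mxmeasurable_LH => //.
have mg := mxmeasurable_sqrt (LH_mxmeasurable Lg).
by do 2 apply: mxmeasurableM => //; exact: LH_mxmeasurable Lf.
Qed.

Lemma slice_lin s (c1 c2 : R) f g x :
  complex.Re (slice nu rho s (fun y => c1%:C *: f y + c2%:C *: g y) x) =
  c1 * complex.Re (slice nu rho s f x) + c2 * complex.Re (slice nu rho s g x).
Proof.
rewrite /slice mulmxDr mulmxDl -!scalemxAr -!scalemxAl mxtraceD !mxtraceZ.
have ReZ c (z : R[i]) : complex.Re (c%:C * z) = c * complex.Re z.
  by case: z => a b /=; rewrite mul0r subr0.
rewrite -!ReZ; by case: (_ * _) (_ * _) => ? ? [].
Qed.

(** The constants [c1] and [c2] of the operator inequality are such that
[c1 a + c2 b = a^(1/p) b^(1/q)], by [1/p + 1/q = 1]. *)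
Lemma L1norm_sandwich_le (p q a b : R) f g : 0 < p -> 0 < q ->
  p^-1 + q^-1 = 1 -> 0 < a -> 0 < b ->
  LH nu rho f -> LH nu rho g -> ae_psd nu rho f -> ae_psd nu rho g ->
  LH nu rho (fun x => (opnorm (f x) `^ p)%:C%:M) ->
  LH nu rho (fun x => mxpowR (g x) q) ->
  (L1norm nu rho (fun x => ((opnorm (f x) `^ p)%:C)%:M) <= a%:E)%E ->
  (L1norm nu rho (fun x => mxpowR (g x) q) <= b%:E)%E ->
  (L1norm nu rho (sandwich f g) <= (a `^ p^-1 * b `^ q^-1)%:E)%E.
Proof.
move=> p0 q0 pq a0 b0 Lf Lg f0 g0 Lfp Lgq fa gb.
set F := fun x => _%:M in Lfp fa; set G := fun x => mxpowR _ q in Lgq gb.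
have F0 x : psdmx (F x) by apply: psdmx_real_scalar; exact: powR_ge0.
have G0 x : psdmx (G x) by exact: mxpowR_psd.
have [Lh h0] := LH_sandwich Lf Lg f0.
apply: (le_trans (L1norm_le_sup Lh h0)); apply: ge_ereal_sup => _ [s _ <-].
set k := a `^ p^-1 * b `^ q^-1.
have k0 : 0 <= k by rewrite mulr_ge0 ?powR_ge0.
pose c1 := k / (a * p); pose c2 := k / (b * q).
have c10 : 0 <= c1 by apply: divr_ge0 => //; apply: mulr_ge0; exact: ltW.
have c20 : 0 <= c2 by apply: divr_ge0 => //; apply: mulr_ge0; exact: ltW.
have mF := LH_mxmeasurable Lfp; have mG := LH_mxmeasurable Lgq.
have msF := measurable_slice nu rho s mF.
have msG := measurable_slice nu rho s mG.
have sF0 x := Re_slice_ge0 nu rho s (F0 x).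
have sG0 x := Re_slice_ge0 nu rho s (G0 x).
pose K x := c1%:C *: F x + c2%:C *: G x.
have mK : mxmeasurable K.
  by apply: mxmeasurableD; apply: mxmeasurableZ => //; exact: cmeasurable_cst.
have K0 x : psdmx (K x).
  by apply: psdmxD; apply: psdmxZ; rewrite ?ler0c.
apply: (@le_trans _ _
  (\int[nu_rho nu rho]_x (complex.Re (slice nu rho s K x))%:E)%E).
  apply: ae_le_integral.
  - by apply: measurable_slice; exact: LH_mxmeasurable Lh.
  - exact: measurable_slice.
  - apply: filterS2 f0 g0 => x fx gx; apply: slice_le.
    by apply: sandwich_young => // u l u0 l0; exact: scaled_young.
  - by apply: aeW => x; exact: Re_slice_ge0.
under eq_integral do rewrite slice_lin EFinD !EFinM.
rewrite ge0_integralD//; first last.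
- exact/measurable_EFinP/measurable_funM.
- by move=> x _; rewrite -EFinM lee_fin mulr_ge0.
- exact/measurable_EFinP/measurable_funM.
- by move=> x _; rewrite -EFinM lee_fin mulr_ge0.
rewrite !ge0_integralZl//; first last.
- by move=> x _; rewrite lee_fin.
- exact/measurable_EFinP.
- by move=> x _; rewrite lee_fin.
- exact/measurable_EFinP.
have -> : k%:E = (c1%:E * a%:E + c2%:E * b%:E)%E.
  rewrite -!EFinM -EFinD; congr EFin.
  rewrite -[LHS]mulr1 -pq /c1 /c2; field.
  by rewrite !gt_eqF.
apply: leeD; apply: lee_wpmul2l; rewrite ?lee_fin//.
  exact: le_trans (integral_slice_le_L1norm s Lfp (aeW _ F0)) fa.
exact: le_trans (integral_slice_le_L1norm s Lgq (aeW _ G0)) gb.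
Qed.

Lemma L1norm_ge0 f : LH nu rho f -> (forall x, psdmx (f x)) ->
  (0 <= L1norm nu rho f)%E.
Proof.
move=> Lf f0; apply: le_trans (integral_slice_le_L1norm rho Lf (aeW _ f0)).
by apply: integral_ge0 => x _; rewrite lee_fin Re_slice_ge0.
Qed.

End sandwich.

(** If both [A] and [B] are positive, take [a = A] and [b = B].  If one of them
vanishes the right-hand side is [0], and the other bound can be kept fixed
while the vanishing one is replaced by the number that makes the product equal
to a given [e > 0]. *)
Lemma le_powR_product {R : realType} (p q : R) (N : \bar R) (A B : R) :
  0 < p -> 0 < q -> 0 <= A -> 0 <= B ->
  (forall a b, 0 < a -> 0 < b -> A <= a -> B <= b ->
     (N <= (a `^ p^-1 * b `^ q^-1)%:E)%E) ->
  (N <= (A `^ p^-1 * B `^ q^-1)%:E)%E.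
Proof.
move=> p0 q0 A0 B0 h.
have powK (r c e : R) : 0 < r -> 0 < c -> 0 < e ->
    ((e / c) `^ r) `^ r^-1 * c = e.
  move=> r0 c0 e0; rewrite -powRrM divff ?gt_eqF// powRr1 ?divfK ?gt_eqF//.
  by rewrite divr_ge0 ?ltW.
have [A_gt0|A_le0] := ltP 0 A; last first.
  have -> : A = 0 by apply/eqP; rewrite eq_le A_le0.
  rewrite powR0 ?invr_eq0 ?gt_eqF// mul0r; apply/lee_addgt0Pr => e e0.
  have b0 : 0 < B + 1 by rewrite ltr_wpDl.
  have c0 := powR_gt0 q^-1 b0.
  rewrite add0e -(powK p _ _ p0 c0 e0); apply: h => //.
  - by rewrite powR_gt0// divr_gt0.
  - by rewrite (le_trans A_le0)// powR_ge0.
  - by rewrite lerDl.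
have [B_gt0|B_le0] := ltP 0 B; last first.
  have -> : B = 0 by apply/eqP; rewrite eq_le B_le0.
  rewrite powR0 ?invr_eq0 ?gt_eqF// mulr0; apply/lee_addgt0Pr => e e0.
  have c0 := powR_gt0 p^-1 A_gt0.
  rewrite add0e -(powK q _ _ q0 c0 e0) mulrC; apply: h => //.
  - by rewrite powR_gt0// divr_gt0.
  - by rewrite (le_trans B_le0)// powR_ge0.
exact: h.
Qed.

Unset Implicit Arguments.

Theorem corollary4p2 (R : realType) (X : ptopologicalType) (n : nat)
    (X_hausdorff : hausdorff_space X)
    (X_lc : locally_compact [set: X])
    (nu : povm R X n) (rho : state R n) (rho_full : \rank rho = n)
    (p q : R) (p_gt1 : 1 < p) (q_gt1 : 1 < q) (pq : p^-1 + q^-1 = 1)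
    (f g : Borel X -> 'M[R[i]]_n)
    (f_LH : LH nu rho f) (g_LH : LH nu rho g)
    (fp_L1 : L1 nu rho (fun x => ((opnorm (f x) `^ p)%:C)%:M))
    (gq_L1 : L1 nu rho (fun x => mxpowR (g x) q))
    (f_ge0 : ae_psd nu rho f) (g_ge0 : ae_psd nu rho g) :
  L1 nu rho (fun x => mxpowR (g x) 2^-1 *m f x *m mxpowR (g x) 2^-1) /\
  (L1norm nu rho (fun x => mxpowR (g x) 2^-1 *m f x *m mxpowR (g x) 2^-1)
   <= (L1norm nu rho (fun x => ((opnorm (f x) `^ p)%:C)%:M)) `^ p^-1
      * (L1norm nu rho (fun x => mxpowR (g x) q)) `^ q^-1)%E.
Proof.
have [Lh _] := LH_sandwich f_LH g_LH f_ge0.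
case: fp_L1 gq_L1 => Lfp + [Lgq].
have p0 : 0 < p by rewrite (lt_trans ltr01).
have q0 : 0 < q by rewrite (lt_trans ltr01).
have A0 : (0 <= L1norm nu rho (fun x => ((opnorm (f x) `^ p)%:C)%:M))%E.
  by apply: L1norm_ge0 => // x; apply: psdmx_real_scalar; exact: powR_ge0.
have B0 : (0 <= L1norm nu rho (fun x => mxpowR (g x) q))%E.
  by apply: L1norm_ge0 => // x; exact: mxpowR_psd.
case EA : (L1norm nu rho (fun x => _%:M)) A0 => [A| |]// A0 _.
case EB : (L1norm nu rho (fun x => mxpowR (g x) q)) B0 => [B| |]// B0 _.
rewrite !poweR_EFin -EFinM.
have hle : (L1norm nu rho
    (fun x => mxpowR (g x) 2^-1 *m f x *m mxpowR (g x) 2^-1)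
    <= (A `^ p^-1 * B `^ q^-1)%:E)%E.
  apply: le_powR_product => // a b a0 b0 Aa Bb.
  by apply: L1norm_sandwich_le => //; rewrite ?EA ?EB lee_fin.
by split=> //; split=> //; exact: le_lt_trans hle (ltry _).
Qed.
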